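(* Let $(W,S)$ be a finitely generated Coxeter system and let $g\in W$ be an element of infinite order. Then in the Cayley graph $\Lambda(W,S)$ the elements $\{\ldots,g^{-2},g^{-1},1,g,g^2,\ldots\}$ are tracked by a Cayley graph geodesic; that is, there are a constant $K$ and a geodesic edge path $\beta$ in $\Lambda(W,S)$ such that for every integer $n$ the vertex $g^n$ is within distance $K$ of a vertex of $\beta$.
   Context: A Coxeter system $(W,S)$ is a group $W$ with generating set $S$ and presentation $\langle S : (s_is_j)^{m(i,j)}\rangle$, where $m(i,j)=m(j,i)\in\{1,2,\ldots,\infty\}$, $m(i,j)=1$ iff $i=j$, and the relation is omitted if $m(i,j)=\infty$; it is finitely generated if $S$ is finite. The Cayley graph $\Lambda(W,S)$ has vertex set $W$ and, for each $w\in W$, $s\in S$, a single edge of length 1 joining $w$ and $ws$; $d$ is the path metric. A geodesic edge path in $\Lambda$ is an edge path (finite, a ray on $[0,\infty)$, or a line on $(-\infty,\infty)$, each unit interval between consecutive integers being mapped isometrically onto an edge) satisfying $d(\beta(s),\beta(t))=|s-t|$ for all integers $s,t$ in its domain. *)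

(* Defs.v *)
From HB Require Import structures.
From mathcomp Require Import all_boot all_order all_algebra.
From mathcomp Require Import boolp classical_sets.

Set Implicit Arguments.
Unset Strict Implicit.
Unset Printing Implicit Defensive.

Local Open Scope group_scope.

(* Words in the letters x_i and x_i^-1; (i, true) stands for x_i and
   (i, false) for x_i^-1. *)
Definition word (I : Type) := seq (I * bool).

Definition word_eval (W : groupType) (I : Type) (s : I -> W) (w : word I) : W :=
  \prod_(l <- w) (if l.2 then s l.1 else (s l.1)^-1).

(* Equality in the group < I | R >: the least congruence on words containing
   the free cancellations and identifying every relator in R with the empty
   word. *)
Inductive pres_eq (I : Type) (R : word I -> Prop) : word I -> word I -> Prop :=
| pres_eq_refl u : pres_eq R u u
| pres_eq_sym u v : pres_eq R u v -> pres_eq R v u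
| pres_eq_trans u v w : pres_eq R u v -> pres_eq R v w -> pres_eq R u w
| pres_eq_cancel u v i b :
    pres_eq R (u ++ [:: (i, b); (i, ~~ b)] ++ v) (u ++ v)
| pres_eq_relator u v r : R r -> pres_eq R (u ++ r ++ v) (u ++ v).

(* The map x_i |-> s i induces an isomorphism from < I | R > onto W. *)
Definition has_presentation (W : groupType) (I : Type) (s : I -> W)
    (R : word I -> Prop) : Prop :=
  (forall x : W, exists w, word_eval s w = x) /\
  (forall u v : word I, word_eval s u = word_eval s v <-> pres_eq R u v).

(* None encodes the value infinity. *)
Definition coxeter_matrix (I : Type) (m : I -> I -> option nat) : Prop :=
  [/\ forall i j, m i j = m j i,
      forall i j, m i j <> Some 0%N
    & forall i j, m i j = Some 1%N <-> i = j].

Definition coxeter_relator (I : Type) (m : I -> I -> option nat)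
    (r : word I) : Prop :=
  exists i j k, m i j = Some k /\
    r = flatten (nseq k [:: (i, true); (j, true)]).

(* The generating set S is the image of the injective family s. *)
Definition coxeter_system (W : groupType) (I : Type) (m : I -> I -> option nat)
    (s : I -> W) : Prop :=
  [/\ coxeter_matrix m, injective s
    & has_presentation s (coxeter_relator m)].

Definition infinite_order (W : groupType) (g : W) : Prop :=
  forall n : nat, (0 < n)%N -> g ^+ n <> 1.

Definition zpow (W : groupType) (g : W) (n : int) : W :=
  match n with
  | Posz k => g ^+ k
  | Negz k => g ^- k.+1
  end.

Definition cayley_adj (W : groupType) (I : finType) (s : I -> W) : rel W :=
  fun u v => [exists i, (v == u * s i) || (u == v * s i)].

Definition walk_of_length (W : groupType) (I : finType) (s : I -> W)
    (u v : W) (n : nat) : Prop :=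
  exists p : seq W, [/\ path (cayley_adj s) u p, last u p = v & size p = n].

(* The default value 0 is irrelevant when s generates W, the graph being then
   connected. *)
Definition cayley_dist (W : groupType) (I : finType) (s : I -> W)
    (u v : W) : nat :=
  xget 0%N [set n | walk_of_length s u v n /\
                    forall k, walk_of_length s u v k -> (n <= k)%N]%classic.

Inductive path_domain := Segment of nat | Ray | Line.

Definition in_domain (D : path_domain) (k : int) : Prop :=
  match D with
  | Segment n => (0 <= k)%R /\ (k <= n%:Z)%R
  | Ray => (0 <= k)%R
  | Line => True
  end.

(* The Cayley graph of a Coxeter system is simple, so an edge path is given by
   its vertices at integer times. Values of b outside D are irrelevant. *)
Definition edge_path (W : groupType) (I : finType) (s : I -> W)
    (D : path_domain) (b : int -> W) : Prop :=
  forall k : int, in_domain D k -> in_domain D (k + 1)%R ->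
    cayley_adj s (b k) (b (k + 1)%R).

Definition geodesic_edge_path (W : groupType) (I : finType) (s : I -> W)
    (D : path_domain) (b : int -> W) : Prop :=
  edge_path s D b /\
  forall k l : int, in_domain D k -> in_domain D l ->
    cayley_dist s (b k) (b l) = absz (k - l)%R.

(* Main.v *)
Require Import Defs.
From HB Require Import structures.
From mathcomp Require Import all_boot all_order all_algebra.
From mathcomp Require Import Rstruct boolp classical_sets reals trigo.
From mathcomp Require Import ring lra zify.

(* Some power of g is conjugate to a straight element k, that is, to one with
   len (k^n) = n len k; the periodic line spelled by a reduced word of k is then
   a geodesic, and a translate of it tracks the powers of g.

   To find k, follow the signs of the roots along the orbits of g in the
   geometric representation.  Only finitely many roots change sign under g, so,
   after passing to a power h of g, the sign of each root along the h-orbit is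
   either constant or constant on both sides of a single exceptional index.
   The barycentre of sufficiently many consecutive points of the h-orbit of the
   fundamental chamber lies in the Tits cone, hence in a closed chamber x.
   Since positive roots have height at least 1, a root with the same sign at
   both ends of its orbit has that sign on the barycentre and all its
   h-translates.  Seen from x, therefore, for a further power of h the sign of
   each root changes at most once, and this makes x^-1 h^N x straight. *)

Set Implicit Arguments.
Unset Strict Implicit.
Unset Printing Implicit Defensive.

Import Order.TTheory GRing.Theory Num.Theory.

(** * The dihedral recurrence *)

Section DihedralRecurrence.
Local Open Scope ring_scope.
Variable R : realType.
Implicit Types (c t : R) (z : nat -> R).

(** Chebyshev polynomials of the second kind, rescaled and shifted by one: [cheb (2 * cos t) n] is
    sin (n t) / sin t when sin t is nonzero. They are the root coefficients in rank two. *)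
Fixpoint cheb c n : R :=
  match n with
  | 0%N => 0
  | 1%N => 1
  | (k.+1 as k1).+1 => c * cheb c k1 - cheb c k
  end.

Lemma chebSS c n : cheb c n.+2 = c * cheb c n.+1 - cheb c n.
Proof. by []. Qed.

Lemma cheb2 n : cheb 2 n = n%:R.
Proof.
suff [] : cheb 2 n = n%:R /\ cheb 2 n.+1 = n.+1%:R by [].
elim: n => [|n [IH1 IH2]]; first by [].
split=> //; rewrite chebSS IH1 IH2 -[n.+2%:R]natr1 -[n.+1%:R]natr1; ring.
Qed.

Lemma sinMnSS t n :
  sin (n.+2%:R * t) = 2 * cos t * sin (n.+1%:R * t) - sin (n%:R * t).
Proof.
have -> : n.+2%:R * t = n.+1%:R * t + t by rewrite -[n.+2%:R]natr1; ring.
have -> : n%:R * t = n.+1%:R * t - t by rewrite -[n.+1%:R]natr1; ring.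
rewrite sinD sinB; ring.
Qed.

Lemma cheb_sin t n : cheb (2 * cos t) n * sin t = sin (n%:R * t).
Proof.
suff [] : cheb (2 * cos t) n * sin t = sin (n%:R * t) /\
  cheb (2 * cos t) n.+1 * sin t = sin (n.+1%:R * t) by [].
elim: n => [|n [IH1 IH2]]; first by rewrite /= !mul0r sin0 !mul1r.
by split=> //; rewrite chebSS sinMnSS -IH1 -IH2; ring.
Qed.

Lemma sin_pi_div_gt0 k : (1 < k)%N -> 0 < sin (pi / k%:R :> R).
Proof.
move=> k1; have k0 : 0 < k%:R :> R by rewrite ltr0n ltnW.
apply: sin_gt0_pi; rewrite divr_gt0 ?pi_gt0 //=.
by rewrite ltr_pdivrMr // ltr_pMr ?pi_gt0 // ltr1n.
Qed.

(** Multiplying by the positive [sin (pi / k%:R)] gives the sine of n pi / k, an angle in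
    [0, pi]. *)
Lemma cheb_ge0 k n : (1 < k)%N -> (n <= k)%N ->
  0 <= cheb (2 * cos (pi / k%:R)) n.
Proof.
move=> k1 nk; have s0 := sin_pi_div_gt0 k1.
have k0 : 0 < k%:R :> R by rewrite ltr0n ltnW.
rewrite -(pmulr_lge0 _ s0) cheb_sin; apply: sin_ge0_pi.
rewrite mulr_ge0 ?divr_ge0 ?pi_ge0 //= mulrA ler_pdivrMr // mulrC.
by rewrite ler_wpM2l ?pi_ge0 // ler_nat.
Qed.

(* [2 sin^2 t * z n] telescopes with step two, and the telescoped quantity has
   period [2 pi / t] *)
Lemma recurrence_sum_eq0 z k (e : nat) : (1 < k)%N ->
  (forall n, z n.+2 = 2 * cos (pi / k%:R) * z n.+1 - z n) ->
  \sum_(l < k) z (2 * l + e)%N = 0.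
Proof.
move=> k1; set t := pi / k%:R => zE.
have s0 : 0 < sin t := sin_pi_div_gt0 k1.
have k0 : k%:R != 0 :> R by rewrite pnatr_eq0; case: k k1 {zE t s0}.
(* [G] results from the product-to-sum formulas applied to the closed form [zs] below. *)
pose G n := z 1%N * cos (n%:R * t - t) - z 0%N * cos (n%:R * t - 2 * t).
have zs n : z n * sin t = z 1%N * sin (n%:R * t) - z 0%N * sin (n%:R * t - t).
  suff [] : z n * sin t = z 1%N * sin (n%:R * t) - z 0%N * sin (n%:R * t - t)
    /\ z n.+1 * sin t =
       z 1%N * sin (n.+1%:R * t) - z 0%N * sin (n.+1%:R * t - t) by [].
  elim: n => [|n [IH1 IH2]].
    rewrite !mul0r mul1r subrr sin0 sub0r sinN; split; ring.
  split=> //.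
  have -> : z n.+2 * sin t = 2 * cos t * (z n.+1 * sin t) - z n * sin t.
    by rewrite zE; ring.
  rewrite IH1 IH2.
  have -> : n.+2%:R * t - t = n.+1%:R * t by rewrite -[n.+2%:R]natr1; ring.
  have -> : n.+1%:R * t - t = n%:R * t by rewrite -[n.+1%:R]natr1; ring.
  rewrite sinMnSS.
  have E : sin (n.+1%:R * t) = 2 * cos t * sin (n%:R * t) - sin (n%:R * t - t).
    rewrite -[n.+1%:R]natr1 mulrDl mul1r sinD sinB; ring.
  rewrite [in X in _ = _ - _ * X]E; ring.
have GE n : 2 * sin t ^+ 2 * z n = G n - G n.+2.
  have -> : 2 * sin t ^+ 2 * z n = 2 * sin t * (z n * sin t) by ring.
  rewrite zs /G.
  have -> : n.+2%:R * t - t = n%:R * t + t by rewrite -[n.+2%:R]natr1 -[n.+1%:R]natr1; ring.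
  have -> : n.+2%:R * t - 2 * t = n%:R * t - t + t by rewrite -[n.+2%:R]natr1 -[n.+1%:R]natr1; ring.
  have -> : n%:R * t - 2 * t = n%:R * t - t - t by ring.
  rewrite (cosB (n%:R * t) t) (cosD (n%:R * t) t) (cosB (_ - _) t) (cosD (_ - _) t); ring.
have c0 : 2 * sin t ^+ 2 != 0 by rewrite mulf_neq0 ?expf_neq0 // ?gt_eqF // pnatr_eq0.
apply: (mulfI c0); rewrite mulr0 mulr_sumr.
under eq_bigr => l _ do rewrite GE.
have -> : \sum_(l < k) (G (2 * l + e)%N - G (2 * l + e).+2) =
  - \sum_(0 <= l < k) (G (2 * l.+1 + e)%N - G (2 * l + e)%N).
  rewrite big_mkord -sumrN; apply: eq_bigr => l _.
  by rewrite mulnS [RHS]opprB.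
have -> := telescope_sumr (fun l => G (2 * l + e)%N) (leq0n k).
rewrite muln0 add0n opprB /G.
have -> : (2 * k + e)%:R * t = e%:R * t + pi *+ 2.
  by rewrite natrD natrM /t -mulr_natl; field.
by rewrite !(addrAC _ (pi *+ 2)) !cosD2pi subrr.
Qed.

End DihedralRecurrence.

(** * The geometric representation *)

Section GeometricRepresentation.
Local Open Scope ring_scope.
Variables (R : realType) (I : finType) (m : I -> I -> option nat).
Hypothesis mP : coxeter_matrix m.

Notation V := {ffun I -> R^o}.
Implicit Types (u v : V) (i j : I).

(* [cartan i j] is twice the Tits form on the pair of simple roots, and
   [coform i v] is twice the form on [v] and [simple i]. *)
Definition cartan i j : R :=
  if m i j is Some k then - (2 * cos (pi / k%:R)) else - 2.

Definition simple i : V := [ffun j => (j == i)%:R].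
Definition coform i v : R := \sum_j v j * cartan j i.
Definition refl i v : V := v - coform i v *: simple i.
Definition form2 u v : R := \sum_i u i * coform i v.
Definition height v : R := \sum_i v i.

Lemma ffunZE a v i : (a *: v) i = a * v i.
Proof. by rewrite ffunE. Qed.

Lemma cartanC i j : cartan i j = cartan j i.
Proof. by rewrite /cartan; case: mP => -> _ _. Qed.

Lemma cartanii i : cartan i i = 2.
Proof.
case: mP => _ _ m1; rewrite /cartan.
by rewrite (_ : m i i = Some 1%N) ?divr1 ?cospi ?mulrN1 ?opprK //; apply/m1.
Qed.

Lemma cartan_le2 i j : cartan i j <= 2.
Proof.
rewrite /cartan; case: (m i j) => [k|]; last by lra.
by have := cos_geN1 (pi / k%:R :> R); lra.
Qed.

Lemma coformD i u v : coform i (u + v) = coform i u + coform i v.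
Proof.
by rewrite /coform -big_split; apply: eq_bigr => j _; rewrite ffunE mulrDl.
Qed.

Lemma coformZ i a v : coform i (a *: v) = a * coform i v.
Proof.
by rewrite /coform mulr_sumr; apply: eq_bigr => j _; rewrite ffunE mulrA.
Qed.

Lemma coformN i v : coform i (- v) = - coform i v.
Proof. by rewrite -scaleN1r coformZ mulN1r. Qed.

Lemma coform_simple i j : coform i (simple j) = cartan j i.
Proof.
rewrite /coform (bigD1 j) //= ffunE eqxx mul1r big1 ?addr0 // => l lj.
by rewrite ffunE (negPf lj) mul0r.
Qed.

Lemma form2C u v : form2 u v = form2 v u.
Proof.
rewrite /form2 /coform; under eq_bigr do rewrite mulr_sumr.
rewrite exchange_big; apply: eq_bigr => i _; rewrite mulr_sumr.
by apply: eq_bigr => j _; rewrite cartanC; ring.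
Qed.

Lemma form2_simple i v : form2 (simple i) v = coform i v.
Proof.
rewrite /form2 (bigD1 i) //= ffunE eqxx mul1r big1 ?addr0 // => l lj.
by rewrite ffunE (negPf lj) mul0r.
Qed.

Lemma form2Dl u v w : form2 (u + v) w = form2 u w + form2 v w.
Proof.
by rewrite /form2 -big_split; apply: eq_bigr => j _; rewrite ffunE mulrDl.
Qed.

Lemma form2Zl a u v : form2 (a *: u) v = a * form2 u v.
Proof.
by rewrite /form2 mulr_sumr; apply: eq_bigr => j _; rewrite ffunE mulrA.
Qed.

Lemma reflD i u v : refl i (u + v) = refl i u + refl i v.
Proof. by rewrite /refl coformD scalerDl opprD addrACA. Qed.

Lemma reflZ i a v : refl i (a *: v) = a *: refl i v.
Proof. by rewrite /refl coformZ scalerBr scalerA. Qed.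

Lemma reflK i : involutive (refl i).
Proof.
move=> v; rewrite /refl coformD coformN coformZ coform_simple cartanii.
apply/ffunP => j; rewrite !(ffunZE, ffunE); ring.
Qed.

Lemma form2_refl i v : form2 (refl i v) (refl i v) = form2 v v.
Proof.
have E b : form2 (v + b *: simple i) (v + b *: simple i) =
    form2 v v + 2 * b * coform i v + 2 * b ^+ 2.
  rewrite form2Dl form2Zl (form2C v) form2Dl form2Zl !form2_simple.
  by rewrite coformD coformZ coform_simple cartanii; ring.
rewrite /refl -scaleNr E; ring.
Qed.

(* An inverse letter acts like the letter itself. *)
Definition act (w : word I) v : V := foldr (fun l => refl l.1) v w.

Lemma act_cat w1 w2 v : act (w1 ++ w2) v = act w1 (act w2 v).
Proof. exact: foldr_cat. Qed.

Lemma actD w u v : act w (u + v) = act w u + act w v.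
Proof. by elim: w => //= l w ->; rewrite reflD. Qed.

Lemma actZ w a v : act w (a *: v) = a *: act w v.
Proof. by elim: w => //= l w ->; rewrite reflZ. Qed.

Lemma form2_act w v : form2 (act w v) (act w v) = form2 v v.
Proof. by elim: w => //= l w IH; rewrite form2_refl. Qed.

(* The coefficients along [simple j], [simple i], [simple j], ... subtracted by
   the successive reflections of an alternating product. *)
Fixpoint alt_coef (c x y : R) n : R :=
  match n with
  | 0%N => y
  | 1%N => x + c * y
  | (k.+1 as k1).+1 => c * alt_coef c x y k1 - alt_coef c x y k
  end.

Lemma act_rotation i j k v (z := alt_coef (- cartan i j) (coform i v) (coform j v)) :
  act (flatten (nseq k [:: (i, true); (j, true)])) v =
  v - (\sum_(l < k) z (2 * l + 1)%N) *: simple i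
    - (\sum_(l < k) z (2 * l)%N) *: simple j.
Proof.
have zS n : z n.+2 = - cartan i j * z n.+1 - z n by [].
elim: k => [|k IH]; first by rewrite !big_ord0 !scale0r !subr0.
(* The coefficient along [simple i] is read after [refl j] has acted, which cancels the summand
   [cartan i j * z (2 * k)]. *)
suff [E1 E2] : coform j (act (flatten (nseq k [:: (i, true); (j, true)])) v)
      = z (2 * k)%N /\
    coform i (act (flatten (nseq k [:: (i, true); (j, true)])) v) =
      z (2 * k).+1 + cartan i j * z (2 * k)%N.
  rewrite -[act _ v]/(refl i (refl j (act (flatten (nseq k [:: (i, true); (j, true)])) v))).
  rewrite [refl j _]/refl E1.
  rewrite [refl i _]/refl coformD coformN coformZ coform_simple.
  rewrite E2 IH !big_ord_recr /= addn1 (cartanC j i).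
  by apply/ffunP => l; rewrite !(ffunZE, ffunE); ring.
rewrite IH; clear IH.
rewrite !(coformD, coformN, coformZ, coform_simple, cartanii) (cartanC j i).
elim: k => [|k [IH1 IH2]].
  by rewrite !big_ord0; split; rewrite ?/z /=; ring.
rewrite !big_ord_recr /= addn1 mulnS !zS.
move: IH1 IH2; set a := \sum_(l < k) _; set b := \sum_(l < k) _.
by move=> <- H; split; lra.
Qed.

Lemma act_relator r : coxeter_relator m r -> forall v, act r v = v.
Proof.
case=> i [j [k [mij ->]]] v; case: mP => mC m0 m1.
have [k1|] := ltnP 1 k; last first.
  rewrite leq_eqVlt ltnS leqn0 => /orP[]/eqP kE; last by case: (m0 i j); rewrite mij kE.
  have /m1 <- : m i j = Some 1%N by rewrite mij kE.
  by rewrite kE /= reflK.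
have cE : - cartan i j = 2 * cos (pi / k%:R) by rewrite /cartan mij opprK.
rewrite act_rotation.
set z := alt_coef _ _ _.
have zE n : z n.+2 = 2 * cos (pi / k%:R) * z n.+1 - z n by rewrite -cE.
rewrite (recurrence_sum_eq0 1 k1 zE).
under eq_bigr => l _ do rewrite -[(2 * l)%N]addn0.
by rewrite (recurrence_sum_eq0 0 k1 zE) !scale0r !subr0.
Qed.

Lemma act_pres (w1 w2 : word I) : pres_eq (coxeter_relator m) w1 w2 ->
  forall v, act w1 v = act w2 v.
Proof.
elim=> {w1 w2} [//|w1 w2 _ IH x|w1 w2 w3 _ IH1 _ IH2 x|w1 w2 i b x|w1 w2 r Rr x].
- by rewrite IH.
- by rewrite IH1 IH2.
- by rewrite !act_cat /= reflK.
- by rewrite !act_cat (act_relator Rr).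
Qed.

End GeometricRepresentation.

(** * Length and roots *)

Section CoxeterGroup.
Local Open Scope ring_scope.
Variables (W : groupType) (I : finType) (m : I -> I -> option nat) (s : I -> W).
Hypothesis hW : coxeter_system m s.
Implicit Types (x y : W) (i j : I) (w : seq I).

Let mP : coxeter_matrix m. Proof. by case: hW. Qed.

(** * Word length and alternating products *)

Section Length.
Local Open Scope nat_scope.
Local Open Scope group_scope.

Definition eval w : W := \prod_(i <- w) s i.

Lemma eval_cat w1 w2 : eval (w1 ++ w2) = eval w1 * eval w2.
Proof. exact: big_cat. Qed.

Lemma eval_cons i w : eval (i :: w) = s i * eval w.
Proof. exact: big_cons. Qed.

Lemma eval1 i : eval [:: i] = s i.
Proof. exact: big_seq1. Qed.

Lemma eval_word w : word_eval s [seq (i, true) | i <- w] = eval w.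
Proof. by rewrite /word_eval big_map. Qed.

Lemma coxeter_rotation i j k : m i j = Some k -> (s i * s j) ^+ k = 1.
Proof.
move=> mij; case: hW => _ _ [_ /(_ (flatten (nseq k [:: (i, true); (j, true)])) [::])].
rewrite {2}/word_eval big_nil => -[_ <-].
  rewrite /word_eval; elim: k {mij} => [|k IH]; first by rewrite big_nil.
  by rewrite /= !big_cons mulgA -IH expgS.
have -> : flatten (nseq k [:: (i, true); (j, true)]) =
  [::] ++ flatten (nseq k [:: (i, true); (j, true)]) ++ [::] by rewrite cats0.
by apply: pres_eq_relator; exists i, j, k.
Qed.

Lemma gen_sqr i : s i * s i = 1.
Proof.
have /coxeter_rotation : m i i = Some 1%N by case: mP => _ _ m1; apply/m1.
by rewrite expg1.
Qed.

Lemma genV i : (s i)^-1 = s i.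
Proof. by apply: mulg1_eq; apply: gen_sqr. Qed.

Lemma genK i x : x * s i * s i = x.
Proof. by rewrite -mulgA gen_sqr mulg1. Qed.

Lemma eval_surj x : exists w, eval w = x.
Proof.
case: hW => _ _ [/(_ x) [w <-] _]; exists [seq l.1 | l <- w].
by rewrite /eval /word_eval big_map; apply: eq_bigr => -[i []] _ //=; rewrite genV.
Qed.

Lemma eval_rev w : eval (rev w) = (eval w)^-1.
Proof.
elim: w => [|i w IH]; first by rewrite /eval !big_nil invg1.
by rewrite rev_cons -cats1 eval_cat eval1 IH eval_cons invgM genV.
Qed.

(** Free cancellations and Coxeter relators all have even length. *)
Lemma eval_parity w1 w2 : eval w1 = eval w2 -> odd (size w1) = odd (size w2).
Proof.
rewrite -!eval_word; case: hW => _ _ [_ H] /H.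
rewrite -(size_map (fun i => (i, true)) w1) -(size_map (fun i => (i, true)) w2).
elim=> {w1 w2} [//|u v _ -> //|u v w _ -> //|u v i b|u v r [i [j [k [_ ->]]]]].
  by rewrite !size_cat /= !addnS /= negbK.
rewrite !size_cat !oddD.
by have -> : odd (size (flatten (nseq k [:: (i, true); (j, true)]))) = false
  by elim: k => //= k ->.
Qed.

Lemma length_exists x : exists n, `[< exists w, eval w = x /\ size w = n >].
Proof. by have [w wx] := eval_surj x; exists (size w); apply/asboolP; exists w. Qed.

Definition len x : nat := ex_minn (length_exists x).

Lemma lenP x : exists2 w, eval w = x & size w = len x.
Proof. by rewrite /len; case: ex_minnP => n /asboolP[w [? ?]] _; exists w. Qed.

Lemma len_eval w : len (eval w) <= size w.
Proof.
rewrite /len; case: ex_minnP => n _; apply.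
by apply/asboolP; exists w.
Qed.

Lemma len1 : len 1 = 0.
Proof.
by apply/eqP; rewrite -leqn0; have := len_eval [::]; rewrite /eval big_nil.
Qed.

Lemma len_eq0 x : len x = 0 -> x = 1.
Proof. by have [w <- <-] := lenP x => /size0nil->; rewrite /eval big_nil. Qed.

Lemma lenM x y : len (x * y) <= len x + len y.
Proof.
have [w <- <-] := lenP x; have [w' <- <-] := lenP y.
by rewrite -eval_cat -size_cat len_eval.
Qed.

Lemma lenV x : len x^-1 = len x.
Proof.
suff H y : len y^-1 <= len y by apply/eqP; rewrite eqn_leq H -{1}[x]invgK H.
by have [w <- <-] := lenP y; rewrite -eval_rev -size_rev len_eval.
Qed.

Lemma len_gen i : len (s i) <= 1.
Proof. by rewrite -eval1 len_eval. Qed.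

Lemma len_gen_parity x i : odd (len (x * s i)) = ~~ odd (len x).
Proof.
have [w1 e1 <-] := lenP x; have [w2 e2 <-] := lenP (x * s i).
have := @eval_parity w2 (rcons w1 i); rewrite size_rcons /= => -> //.
by rewrite -cats1 eval_cat eval1 e1 e2.
Qed.

Lemma len_gen_cases x i :
  len (x * s i) = (len x).+1 \/ (len (x * s i)).+1 = len x.
Proof.
have := len_gen_parity x i.
have := lenM x (s i); have := lenM (x * s i) (s i); rewrite genK.
have := len_gen i; lia.
Qed.

(** The rightmost factor is always [s j]; new factors enter on the left, where they act last on a
    root. *)
Fixpoint alt k i j : W :=
  if k is k'.+1 then s (if odd k' then i else j) * alt k' i j else 1.

Lemma alt_recr k i j : alt k.+1 i j = alt k j i * s j.
Proof.
elim: k i j => [|k IH] i j; first by rewrite /= mulg1 mul1g.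
rewrite -[LHS]/(s (if odd k.+1 then i else j) * alt k.+1 i j) IH mulgA /=.
by case: (odd k).
Qed.

Lemma len_alt k i j : len (alt k i j) <= k.
Proof.
elim: k => [|k IH]; first by rewrite len1.
exact: leq_trans (lenM _ _) (leq_add (len_gen _) IH).
Qed.

Lemma alt_split q k i j : q <= k ->
  exists2 x, alt k i j = x * alt q i j & len x <= k - q.
Proof.
elim: k => [|k IH].
  by rewrite leqn0 => /eqP->; exists 1; rewrite ?mulg1 // len1.
rewrite leq_eqVlt => /orP[/eqP->|qk]; first by exists 1; rewrite ?mul1g // len1.
have [x E lx] := IH qk; exists (s (if odd k then i else j) * x).
  by rewrite /= E mulgA.
by rewrite subSn //; apply: leq_trans (lenM _ _) (leq_add (len_gen _) lx).
Qed.

(** Cutting the word of [(s i * s j) ^+ k] in the middle turns a Coxeter relation into a braid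
    relation. *)
Lemma alt_rotation k i j : (alt k j i)^-1 * alt k i j = (s i * s j) ^+ k.
Proof.
elim: k i j => [|k IH] i j; first by rewrite /= mulg1 invg1.
rewrite !alt_recr invgM genV -mulgA (mulgA _ _ (s j)) IH.
elim: k {IH} => [|k IH]; first by rewrite mul1g expg1.
by rewrite [RHS]expgS -IH expgS !mulgA.
Qed.

Lemma alt_braid k i j : m i j = Some k -> alt k i j = alt k j i.
Proof.
move=> /coxeter_rotation; rewrite -alt_rotation => /mulg1_eq.
by rewrite invgK.
Qed.

End Length.

(** * Roots, their signs and inversions *)

Section Roots.
Variable R : realType.
Notation V := {ffun I -> R^o}.
Notation simple := (@simple R I).
Implicit Types (u v : V).

(** An arbitrary choice of word; by [action_word] the action does not depend on it. *)
Definition expr_of x : word I :=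
  [seq (i, true) | i <- sval (cid (eval_surj x))].

Definition action x v : V := act m (expr_of x) v.

Lemma action_word (w : word I) v : act m w v = action (word_eval s w) v.
Proof.
apply: act_pres => //; case: hW => _ _ [_ H]; apply/H.
by rewrite eval_word; case: cid.
Qed.

Lemma actionM x y v : action (x * y)%g v = action x (action y v).
Proof.
rewrite -[RHS]act_cat action_word /word_eval big_cat.
by rewrite -!/(word_eval _ _) !eval_word; do 2!case: cid => /= ? ->.
Qed.

Lemma action1 v : action 1%g v = v.
Proof. by have := action_word [::] v; rewrite /word_eval big_nil. Qed.

Lemma action_gen i v : action (s i) v = refl m i v.
Proof. by rewrite -eval1 -eval_word -action_word. Qed.

Lemma actionK x v : action x^-1%g (action x v) = v.
Proof. by rewrite -actionM mulVg action1. Qed.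

Lemma actionVK x v : action x (action x^-1%g v) = v.
Proof. by rewrite -actionM mulgV action1. Qed.

Lemma actionD x u v : action x (u + v) = action x u + action x v.
Proof. exact: actD. Qed.

Lemma actionZ x a v : action x (a *: v) = a *: action x v.
Proof. exact: actZ. Qed.

Lemma actionN x v : action x (- v) = - action x v.
Proof. by rewrite -scaleN1r actionZ scaleN1r. Qed.

Lemma refl_simple i : refl m i (simple i) = - simple i.
Proof.
rewrite /refl coform_simple cartanii //.
by apply/ffunP => j; rewrite !(ffunZE, ffunE); ring.
Qed.

Definition nonneg v := [forall i, 0 <= v i].

Lemma nonnegP v : reflect (forall i, 0 <= v i) (nonneg v).
Proof. exact: forallP. Qed.

Lemma nonnegD u v : nonneg u -> nonneg v -> nonneg (u + v).
Proof.
by move=> /nonnegP hu /nonnegP hv; apply/nonnegP => i; rewrite ffunE addr_ge0.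
Qed.

Lemma nonnegZ a v : 0 <= a -> nonneg v -> nonneg (a *: v).
Proof. by move=> ha /nonnegP hv; apply/nonnegP => i; rewrite ffunZE mulr_ge0. Qed.

Lemma nonneg_simple i : nonneg (simple i).
Proof. by apply/nonnegP => j; rewrite ffunE ler0n. Qed.

Lemma action_alt k i j : i != j ->
  let u := cheb (- cartan R m i j) in
  action (alt k i j) (simple i) =
    (if odd k then u k else u k.+1) *: simple i +
    (if odd k then u k.+1 else u k) *: simple j.
Proof.
move=> ij u; elim: k => [|k IH].
  by rewrite action1 /= scale1r scale0r addr0.
rewrite [alt _ _ _]/= actionM IH action_gen /refl.
have Cji : cartan R m j i = cartan R m i j by rewrite cartanC.
rewrite [odd k.+1]/= /u chebSS -/u; case: (odd k) => /=;
  rewrite coformD !coformZ !coform_simple cartanii // ?Cji;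
  by apply/ffunP => l; rewrite !(ffunZE, ffunE); ring.
Qed.

(* Peel off from the right of [x] the longest alternating word in [i], [j]; on
   the remaining factor both letters increase the length. *)
Lemma simple_nonneg x i :
  (len x < len (x * s i)%g)%N -> nonneg (action x (simple i)).
Proof.
have [n] := ubnP (len x); elim: n => [//|n IH] in x i *.
rewrite ltnS => xn xi.
have [x0|x0] := posnP (len x).
  by rewrite (len_eq0 x0) action1 nonneg_simple.
have [j xj] : exists j, (len (x * s j)%g < len x)%N.
  have [w wx wl] := lenP x; case/lastP: w wx wl => [|w j wx wl].
    by move=> _ /= E; rewrite -E in x0.
  exists j; rewrite -wl size_rcons ltnS -wx -cats1 eval_cat eval1 genK.
  exact: len_eval.
have ij : i != j by apply: contraTneq xi => ->; rewrite -leqNgt ltnW.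
(* [P k] says that an alternating product of [k] letters splits off [x] with no loss of length. *)
pose P k := (len (x * (alt k i j)^-1) + k == len x)%N.
have P1 : P 1%N.
  rewrite /P /= mulg1 genV; have := len_gen_cases x j; lia.
have Pb k : P k -> (k <= len x)%N by move=> /eqP<-; apply: leq_addl.
case: (ex_maxnP (ex_intro P 1%N P1) Pb) => k /eqP Pk kmax.
have k0 : (0 < k)%N := kmax 1%N P1.
set v := (x * (alt k i j)^-1)%g in Pk.
have xE : x = (v * alt k i j)%g by rewrite /v mulgVK.
(* Otherwise one more letter could be peeled off, against the maximality of [k]. *)
have up1 : (len v < len (v * s (if odd k then i else j))%g)%N.
  have := len_gen_cases v (if odd k then i else j).
  have : ~~ P k.+1 by apply/negP => /kmax; rewrite ltnn.
  rewrite /P /= invgM genV mulgA -/v.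
  by move: (len (v * s _)%g) => A; lia.
(* This letter is the leftmost one of [alt k i j]; if it shortened [v], then [x] would be shorter
   than [len v + k]. *)
have up2 : (len v < len (v * s (if odd k then j else i))%g)%N.
  have := lenM (v * s (if odd k then j else i))%g (alt k.-1 i j).
  rewrite -mulgA.
  have -> : (s (if odd k then j else i) * alt k.-1 i j)%g = alt k i j.
    by case: k k0 {kmax Pk v xE up1} => //= k _; case: (odd k).
  rewrite -xE; have := len_alt k.-1 i j.
  by move: (len (v * s _)%g) => A; lia.
have vn : (len v < n)%N by lia.
have [vi vj] : nonneg (action v (simple i)) /\ nonneg (action v (simple j)).
  by case: (odd k) up1 up2 => ? ?; split; apply: IH.
rewrite xE actionM action_alt // actionD !actionZ.
have u0 l : (l <= k.+1)%N -> 0 <= cheb (- cartan R m i j) l.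
  move=> lk; rewrite /cartan; case mij: (m i j) => [q|]; last first.
    by rewrite opprK cheb2.
  have q1 : (1 < q)%N.
    case: mP => _ m0 m1; case: q mij => [/m0 //|[/m1 E|//]].
    by rewrite E eqxx in ij.
  rewrite opprK; apply: cheb_ge0 => //; apply: leq_trans lk _.
  (* If [q <= k], the braid relation rewrites the tail of [x] to end in [s i], so that [x * s i] is
     not longer than [x]. *)
  rewrite ltnNge; apply/negP => qk.
  have [y yE ly] := alt_split i j qk.
  move: xi; rewrite {2}xE yE (alt_braid mij).
  case: q q1 {mij} qk yE ly => // q q1 qk yE ly.
  rewrite alt_recr !mulgA genK -mulgA.
  have := lenM v (y * alt q i j); have := lenM y (alt q i j).
  have := len_alt q i j.
  move: (len (v * _)%g) (len (y * _)%g) => A B.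
  by clear -Pk qk ly; lia.
by apply: nonnegD; apply: nonnegZ => //; case: ifP => _; apply: u0.
Qed.

Definition is_root v := exists x i, v = action x (simple i).

Lemma root_simple i : is_root (simple i).
Proof. by exists 1%g, i; rewrite action1. Qed.

Lemma root_action x v : is_root v -> is_root (action x v).
Proof. by case=> y [i ->]; exists (x * y)%g, i; rewrite actionM. Qed.

Lemma root_opp v : is_root v -> is_root (- v).
Proof.
case=> x [i ->]; exists (x * s i)%g, i.
by rewrite actionM action_gen refl_simple actionN.
Qed.

Lemma root_sign v : is_root v -> nonneg v || nonneg (- v).
Proof.
case=> x [i ->]; have [xi|xi] := len_gen_cases x i.
  by rewrite simple_nonneg ?xi.
apply/orP; right; rewrite -actionN -refl_simple -action_gen -actionM.
by apply: simple_nonneg; rewrite genK -xi.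
Qed.

Lemma root_form2 v : is_root v -> form2 m v v = 2.
Proof.
by case=> x [i ->]; rewrite form2_act // form2_simple coform_simple cartanii.
Qed.

Lemma root_opp_nonneg v : is_root v -> nonneg (- v) = ~~ nonneg v.
Proof.
move=> rv; have := root_sign rv; case: (boolP (nonneg v)) => //= v0 _.
apply/negP => vN; have v00 : v = 0.
  apply/ffunP => i; apply/eqP; rewrite [X in _ == X]ffunE eq_le.
  rewrite (nonnegP _ v0) andbT.
  by have := nonnegP _ vN i; rewrite ffunE oppr_ge0.
have := root_form2 rv; rewrite v00 /form2 big1 => [/eqP|i _].
  by rewrite eq_sym pnatr_eq0.
by rewrite ffunE mul0r.
Qed.

(* [2 = form2 v v <= 2 * (height v)^2] because [cartan] is at most 2. *)
Lemma height_ge1 v : is_root v -> nonneg v -> 1 <= height v.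
Proof.
move=> rv /nonnegP v0; have h0 : 0 <= height v by apply: sumr_ge0.
suff : 2 <= 2 * height v ^+ 2 by nra.
have -> : 2 * height v ^+ 2 = \sum_i v i * (2 * height v).
  by rewrite -mulr_suml -/(height v); ring.
rewrite -[X in X <= _](root_form2 rv); apply: ler_sum => i _.
rewrite ler_wpM2l ?v0 // /height mulr_sumr; apply: ler_sum => j _.
by rewrite mulrC ler_wpM2r ?v0 // cartan_le2.
Qed.

Lemma heightN v : height (- v) = - height v.
Proof. by rewrite /height -sumrN; apply: eq_bigr => i _; rewrite ffunE. Qed.

Lemma height_leN1 v : is_root v -> ~~ nonneg v -> height v <= -1.
Proof.
move=> rv v0; have := @height_ge1 (- v) (root_opp rv).
by rewrite root_opp_nonneg // heightN => /(_ v0); lra.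
Qed.

(** The reflection alters only the coordinate [i], and the root has another positive coordinate: a
    root proportional to [simple i] and positive equals it, since both have norm 2. *)
Lemma refl_nonneg i v : is_root v -> nonneg v -> v != simple i ->
  nonneg (refl m i v).
Proof.
move=> rv v0 vi; have rr : is_root (refl m i v) by rewrite -action_gen; apply: root_action.
have [j ji vj] : exists2 j, j != i & 0 < v j.
  apply: contrapT => H; case/eqP: vi.
  have vE : v = v i *: simple i.
    apply/ffunP => j; rewrite ffunZE ffunE.
    have [->|ji] := eqVneq j i; first by rewrite mulr1.
    rewrite mulr0; apply/eqP; rewrite eq_le (nonnegP _ v0) andbT leNgt.
    by apply/negP => vj; apply: H; exists j.
  have := root_form2 rv; rewrite vE form2Zl form2_simple coformZ coform_simple.
  rewrite cartanii // => E; have := nonnegP _ v0 i; set a := v i in E * => a0.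
  have -> : a = 1 by nra.
  by rewrite scale1r.
apply: contraLR vj; rewrite -root_opp_nonneg // => /nonnegP /(_ j).
by rewrite !(ffunZE, ffunE) (negPf ji) mulr0 subr0 oppr_ge0 leNgt.
Qed.

Lemma len_nonneg x i : (len x < len (x * s i)%g)%N = nonneg (action x (simple i)).
Proof.
apply/idP/idP; first exact: simple_nonneg.
rewrite ltnNge; apply: contraL => le.
have := @simple_nonneg (x * s i)%g i; rewrite genK actionM action_gen refl_simple actionN.
rewrite root_opp_nonneg; last exact/root_action/root_simple.
by apply; have := len_gen_cases x i; lia.
Qed.

(** The hypothesis says that [x] and [y^-1] have no common inversion. Induction on [len y] moves the
    first letter of a reduced word of [y] over to [x]. *)
Lemma lenM_eq x y :
  (forall v, is_root v -> nonneg v -> nonneg (action y^-1%g v) || nonneg (action x v)) ->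
  len (x * y)%g = (len x + len y)%N.
Proof.
have [n] := ubnP (len y); elim: n => [//|n IH] in x y *; rewrite ltnS => yn H.
have [y0|y0] := posnP (len y).
  by rewrite (len_eq0 y0) mulg1 len1 addn0.
have [w wy wl] := lenP y; case: w wy wl => [|i w] wy wl.
  by rewrite -wl in y0.
set y' := eval w; have yE : y = (s i * y')%g by rewrite -wy eval_cons.
have ly' : len y = (len y').+1.
  apply/eqP; rewrite eqn_leq -{2}wl ltnS len_eval andbT yE.
  exact: leq_trans (lenM _ _) (leq_add (len_gen _) (leqnn _)).
(* The first letter of a reduced word of [y] is an inversion of [y^-1], hence not of [x], so it
   lengthens [x]. *)
have yi : ~~ nonneg (action y^-1%g (simple i)).
  rewrite -len_nonneg yE invgM genV genK -[(y'^-1 * s i)%g]invgK invgM invgK genV.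
  by rewrite !lenV -yE ly' -leqNgt.
have y'i : nonneg (action y'^-1%g (simple i)).
  move: yi; rewrite yE invgM genV actionM action_gen refl_simple actionN.
  by rewrite root_opp_nonneg ?negbK //; exact/root_action/root_simple.
have xi : nonneg (action x (simple i)).
  by have := H _ (root_simple i) (nonneg_simple i); rewrite (negPf yi).
have -> : (x * y = (x * s i) * y')%g by rewrite yE mulgA.
rewrite IH; last 2 first.
- by rewrite -ly'.
(* For the pair [x * s i], [y'], the hypothesis at [v] is the old one at the reflected root, except
   at [simple i]. *)
- move=> v rv v0; have [->|vi] := eqVneq v (simple i); first by rewrite y'i.
  have := H _ (root_action (s i) rv); rewrite {1}action_gen refl_nonneg //.
  by rewrite -!actionM yE invgM -mulgA mulVg mulg1 => /(_ isT).
by move: xi; rewrite -len_nonneg; have := len_gen_cases x i; lia.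
Qed.

(** An extra last letter [i] adds at most [simple i] and carries the other inversions back by
    [refl m i]. *)
Lemma inversions_finite x : exists L : seq V,
  forall v, is_root v -> nonneg v -> ~~ nonneg (action x v) -> v \in L.
Proof.
have [w <-] := eval_surj x; elim/last_ind: w => [|w i [L LP]].
  by exists [::] => v _ v0; rewrite /eval big_nil action1 v0.
exists (simple i :: [seq refl m i v | v <- L]) => v rv v0.
rewrite -cats1 eval_cat eval1 actionM action_gen inE => vn.
have [//|vi] := eqVneq v (simple i).
apply/orP; right; rewrite -[v](reflK (m := m) mP i) map_f //.
by apply: LP => //; [rewrite -action_gen; apply: root_action|apply: refl_nonneg].
Qed.

(* Reflecting in a simple root on which [p] is negative removes one positive
   root from the finite set on which [p] is negative. *)
Lemma to_chamber (p : V -> R) (L : seq V) : (forall v, p (- v) = - p v) ->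
  (forall v, is_root v -> nonneg v -> p v < 0 -> v \in L) ->
  exists x, forall i, 0 <= p (action x (simple i)).
Proof.
have [n] := ubnP (size L); elim: n => [//|n IH] in p L *.
rewrite ltnS => Ln pN LP.
have [[i pi]|H] := pselect (exists i, p (simple i) < 0); last first.
  exists 1%g => i; rewrite action1 leNgt; apply/negP => pi; apply: H; by exists i.
have iL : simple i \in L by apply: LP => //; [apply: root_simple|apply: nonneg_simple].
have [|||x xP] := IH (p \o refl m i) [seq refl m i v | v <- L & v != simple i].
- rewrite size_map size_filter; apply: leq_trans Ln.
  rewrite -(count_predC (fun v => v != simple i) L) -[X in (X < _)%N]addn0 ltn_add2l.
  by rewrite -has_count; apply/hasP; exists (simple i) => //=; rewrite eqxx.
- by move=> v /=; rewrite -!action_gen actionN pN.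
- move=> v rv v0 /= pv; rewrite -[v](reflK (m := m) mP i) map_f // mem_filter.
  have vi : v != simple i.
    apply: contraTneq pv => ->; rewrite refl_simple pN -leNgt oppr_ge0; exact: ltW.
  apply/andP; split.
    apply: contraTneq v0 => rvi; rewrite -[v](reflK (m := m) mP i) rvi refl_simple.
    by rewrite root_opp_nonneg ?nonneg_simple //; apply: root_simple.
  by apply: LP => //; [rewrite -action_gen; apply: root_action|apply: refl_nonneg].
by exists (s i * x)%g => j; rewrite actionM action_gen; apply: xP.
Qed.

Lemma simple_expansion v : v = \sum_i v i *: simple i.
Proof.
apply/ffunP => j; rewrite sum_ffunE (bigD1 j) //= ffunZE ffunE eqxx mulr1.
rewrite big1 ?addr0 // => i ij; rewrite ffunZE ffunE eq_sym (negPf ij).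
exact: mulr0.
Qed.

(** Once [x] carries [p] into the closed chamber, [p] composed with [action x] is nonnegative on
    nonnegative vectors. Roots on which [p] vanishes stay unconstrained. *)
Lemma chamber_root (p : V -> R) (L : seq V) :
  (forall u v, p (u + v) = p u + p v) -> (forall a v, p (a *: v) = a * p v) ->
  (forall v, is_root v -> nonneg v -> p v < 0 -> v \in L) ->
  exists x, forall v, is_root v ->
    (0 < p v -> nonneg (action x^-1%g v)) /\
    (p v < 0 -> ~~ nonneg (action x^-1%g v)).
Proof.
move=> pD pZ LP; have pN v : p (- v) = - p v by rewrite -scaleN1r pZ mulN1r.
have [x xP] := to_chamber pN LP; exists x.
have p0 v : nonneg v -> 0 <= p (action x v).
  move=> /nonnegP v0; rewrite (simple_expansion v).
  have -> : p (action x (\sum_i v i *: simple i)) =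
            \sum_i v i * p (action x (simple i)).
    elim/big_ind2: _ => [|u a u' a' <- <-|i _]; last by rewrite actionZ pZ.
      by rewrite -(scale0r 0) actionZ pZ mul0r.
    by rewrite actionD pD.
  by apply: sumr_ge0 => i _; rewrite mulr_ge0.
have H v : is_root v -> 0 < p v -> nonneg (action x^-1%g v).
  move=> rv; apply: contraTT; rewrite -root_opp_nonneg; last exact: root_action.
  by move=> /p0; rewrite actionN actionVK pN oppr_ge0 -leNgt.
move=> v rv; split; first exact: H.
move=> pv; rewrite -root_opp_nonneg -?actionN; last exact: root_action.
by apply: H; [apply: root_opp|rewrite pN oppr_gt0].
Qed.

End Roots.
End CoxeterGroup.

(** * Signs of roots along an orbit *)

Section IntegerPowers.
Local Open Scope ring_scope.
Variable W : groupType.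
Implicit Types (g x : W) (n k : int).

Lemma zpow1Dr g n : zpow g (n + 1) = (zpow g n * g)%g.
Proof.
case: n => [n|[|n]].
- have -> : Posz n + 1 = Posz n.+1 by lia.
  by rewrite /= expgSr.
- by rewrite /= expg1 mulVg.
- have -> : Negz n.+1 + 1 = Negz n by lia.
  by rewrite /= [in RHS]expgS invgM mulgVK.
Qed.

Lemma zpowD g n k : zpow g (n + k) = (zpow g n * zpow g k)%g.
Proof.
elim: k => [|k IH|k IH]; first by rewrite addr0 mulg1.
  by rewrite -addn1 PoszD addrA !zpow1Dr IH mulgA.
apply: (mulIg g); rewrite -mulgA -!zpow1Dr -addrA.
by have -> : - k.+1%:Z + 1 = - k%:Z by lia.
Qed.

Lemma zpowN1 g : zpow g (-1) = g^-1%g.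
Proof. by rewrite -[-1]/(Negz 0) /= expg1. Qed.

Lemma zpowX g (k : nat) n : zpow (g ^+ k)%g n = zpow g (k%:Z * n).
Proof.
elim: n => [|n IH|n IH]; first by rewrite mulr0.
  by rewrite -addn1 PoszD zpow1Dr IH mulrDr mulr1 zpowD.
apply: (mulIg (g ^+ k)%g); rewrite -zpow1Dr.
have -> : - n.+1%:Z + 1 = - n%:Z by lia.
rewrite IH -[(g ^+ k)%g]/(zpow g k) -zpowD; congr zpow; lia.
Qed.

Lemma zpow_conj g x n : zpow (x^-1 * g * x)%g n = (x^-1 * zpow g n * x)%g.
Proof.
elim: n => [|n IH|n IH]; first by rewrite /= mulg1 mulVg.
  by rewrite -addn1 PoszD !zpow1Dr IH !mulgA mulgK.
apply: (mulIg (x^-1 * g * x)%g); rewrite -zpow1Dr.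
rewrite -!mulgA mulVKg !mulgA -[(x^-1 * _ * g)%g]mulgA -zpow1Dr.
have -> : - n.+1%:Z + 1 = - n%:Z by lia.
by rewrite IH.
Qed.

End IntegerPowers.

Section UniformBounds.
Local Open Scope ring_scope.

Lemma seq_bound (T : eqType) (P : T -> nat -> Prop) (L : seq T) :
  (forall x a b, (a <= b)%N -> P x a -> P x b) ->
  (forall x, x \in L -> exists a, P x a) ->
  exists a, forall x, x \in L -> P x a.
Proof.
move=> mono; elim: L => [|y L IH] H; first by exists 0%N.
have [|a aP] := IH; first by move=> x xL; apply: H; rewrite inE xL orbT.
have [b bP] := H y (mem_head _ _); exists (maxn a b) => x.
rewrite inE => /orP[/eqP->|/aP]; first exact: mono (leq_maxr a b) bP.
exact/mono/leq_maxl.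
Qed.

Lemma const_right (f : int -> bool) (a : int) :
  (forall n : int, a <= n -> f (n + 1) = f n) -> forall n : int, a <= n -> f n = f a.
Proof.
move=> H n an; have -> : n = a + `|n - a|%N by lia.
elim: `|n - a|%N => [|k IH]; first by rewrite addr0.
rewrite -addn1 PoszD addrA H ?IH //; lia.
Qed.

Lemma const_left (f : int -> bool) (a : int) :
  (forall n : int, n < a -> f (n + 1) = f n) -> forall n : int, n <= a -> f n = f a.
Proof.
move=> H n an; have -> : n = a - `|n - a|%N%:Z by lia.
elim: `|n - a|%N => [|k IH]; first by rewrite subr0.
rewrite -IH -H; last lia.
congr f; lia.
Qed.

End UniformBounds.

(** * From sign patterns along orbits to a straight element *)

Section Dynamics.
Local Open Scope ring_scope.
Variables (W : groupType) (I : finType) (m : I -> I -> option nat) (s : I -> W).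
Hypothesis hW : coxeter_system m s.
Variable R : realType.
Notation V := {ffun I -> R^o}.
Implicit Types (u v : V) (g h x : W).

Notation is_root := (@is_root W I m s hW R).
Notation action := (action hW).

Lemma sign_changes_finite g : exists F : seq V, forall v, is_root v ->
  nonneg (action g v) != nonneg v -> v \in F.
Proof.
have [L LP] := @inversions_finite _ _ _ _ hW R g.
exists (L ++ [seq - v | v <- L]) => v rv; rewrite mem_cat.
have [v0|v0] := boolP (nonneg v); first by rewrite eqb_id => /LP->.
rewrite eqbF_neg negbK => gv; apply/orP; right.
rewrite -[v]opprK map_f //; apply: LP; first exact: root_opp.
  by rewrite (root_opp_nonneg rv).
by rewrite actionN (root_opp_nonneg (root_action g rv)) negbK.
Qed.

Definition periodic g v k := (0 < k)%N /\ action (g ^+ k)%g v = v.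

Lemma periodicM g v k l : (0 < l)%N -> periodic g v k -> periodic g v (l * k)%N.
Proof.
move=> l0 [k0 kv]; split; first by rewrite muln_gt0 l0.
elim: l {l0} => [|l IH]; first by rewrite action1.
by rewrite mulSn expgnDr actionM IH.
Qed.

Lemma nonperiodic_inj g v : (forall k, ~ periodic g v k) ->
  injective (fun n : int => action (zpow g n) v).
Proof.
move=> np; suff H (a b : int) : a < b -> action (zpow g a) v = action (zpow g b) v -> False.
  move=> a b E; case: (ltgtP a b) => // ab; first by case: (H _ _ ab E).
  by case: (H _ _ ab (esym E)).
move=> ab E; apply: (np `|b - a|%N); split; first lia.
have -> : (g ^+ `|b - a|)%g = zpow g (- a + b).
  have -> : - a + b = Posz `|b - a|%N by lia.
  by [].
by rewrite zpowD actionM -E -actionM -zpowD addNr action1.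
Qed.

(** An infinite orbit meets each member of [L] at most once. *)
Lemma nonperiodic_bounded g v (L : seq V) : (forall k, ~ periodic g v k) ->
  exists b, forall n : int, action (zpow g n) v \in L -> (`|n|%N <= b)%N.
Proof.
move=> np.
have [||b bP] := @seq_bound _
  (fun u b => forall n : int, action (zpow g n) v = u -> (`|n|%N <= b)%N) L.
- by move=> u a b ab H n /H; move/leq_trans; apply.
- move=> u _; have [[n nu]|H] := pselect (exists n, action (zpow g n) v = u).
    by exists `|n|%N => k; rewrite -nu => /(nonperiodic_inj np)->.
  by exists 0%N => n nu; case: H; exists n.
by exists b => n nL; apply: bP nL _ _.
Qed.

(* A root whose sign changes along the orbit of [g] is a translate of one of
   the finitely many roots whose sign is changed by [g] itself; either it is
   periodic or its sign changes within a window of uniformly bounded size. *)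
Lemma sign_window g : exists (M b : nat) (F : seq V),
  (0 < M)%N /\ forall v, is_root v ->
  [\/ forall n : int, nonneg (action (zpow g n) v) = nonneg v,
      action (g ^+ M)%g v = v
    | exists (n0 : int) (e1 e2 : bool),
       [/\ forall n : int, n0 + b%:Z < n -> nonneg (action (zpow g n) v) = e1,
           forall n : int, n < n0 - b%:Z -> nonneg (action (zpow g n) v) = e2
         & action (zpow g n0) v \in F] ].
Proof.
have [F FP] := sign_changes_finite g.
have [||k kP] := @seq_bound _ (fun v k => (exists j, periodic g v j) ->
    exists2 j, (0 < j <= k)%N & periodic g v j) F.
- move=> v a b ab H /H[j /andP[j0 ja] jv]; exists j => //.
  by rewrite j0 (leq_trans ja).
- move=> v _; have [[j jv]|H] := pselect (exists j, periodic g v j); last by exists 0%N.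
  by exists j => _; exists j => //; case: jv => ->; rewrite leqnn.
have [||b bP] := @seq_bound _ (fun v b => (forall j, ~ periodic g v j) ->
    forall n : int, action (zpow g n) v \in F -> (`|n|%N <= b)%N) F.
- by move=> v a b ab H np n /(H np)/leq_trans; apply.
- move=> v _; have [[j jv]|H] := pselect (exists j, periodic g v j).
    by exists 0%N => /(_ j).
  have [b bP] := @nonperiodic_bounded g v F (fun j jv => H (ex_intro _ j jv)).
  by exists b.
(* [k] bounds the minimal known periods of the periodic members of [F], so the factorial is a common
   period of them all. *)
exists k`!, b.+1, F; split; first exact: fact_gt0.
move=> v rv; pose f (n : int) := nonneg (action (zpow g n) v).
have fF n : f (n + 1) != f n -> action (zpow g n) v \in F.
  move=> fn; apply: FP; first exact: root_action.
  by rewrite -actionM -[g]/(zpow g 1) -zpowD addrC.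
have [[n0 /fF n0F]|nc] := pselect (exists n, f (n + 1) != f n); last first.
  have fS n : f (n + 1) = f n by apply: contrapT => H; apply: nc; exists n; apply/eqP.
  apply: Or31 => n; rewrite -[nonneg v](_ : f 0 = _); last by rewrite /f action1.
  case: (lerP 0 n) => n0; first by rewrite -/(f n) (const_right (f := f) (a := 0)).
  by rewrite -/(f n) (const_left (f := f) (a := 0)) // ltW.
set u := action (zpow g n0) v in n0F.
have uE n : action (zpow g n) u = action (zpow g (n + n0)) v by rewrite zpowD actionM.
have [/(kP _ n0F)[i /andP[i0 ik] iu]|np] := pselect (exists j, periodic g u j).
  apply: Or32; have /dvdnP[l lE] : (i %| k`!)%N by rewrite dvdn_fact // i0.
  have [|_ E] := @periodicM g u i l _ iu.
    by rewrite lt0n; apply: contraTneq (fact_gt0 k) => l0; rewrite lE l0.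
  rewrite -lE in E; apply: (can_inj (actionK hW (zpow g n0))).
  by rewrite -actionM -[(g ^+ _)%g]/(zpow g k`!) -zpowD addrC zpowD actionM.
have {bP kP} bP := bP _ n0F (fun j jv => np (ex_intro _ j jv)).
have fb n : f (n + 1) != f n -> (`|n - n0|%N <= b)%N.
  by move=> /fF nF; apply: bP; rewrite uE subrK.
apply: Or33; exists n0, (f (n0 + b%:Z + 1)), (f (n0 - b%:Z)); split=> //.
  move=> n nb; apply: (const_right (f := f)); last lia.
  move=> l nl; apply: contrapT => /eqP/fb; lia.
move=> n nb; apply: (const_left (f := f)); last lia.
move=> l nl; apply: contrapT => /eqP/fb; lia.
Qed.

Definition signed (e : bool) (a : R) := if e then a else - a.

Lemma signed_height v : is_root v -> 1 <= signed (nonneg v) (height v).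
Proof.
move=> rv; rewrite /signed; case: ifP => v0; first exact: height_ge1 rv v0.
by rewrite lerNr; apply: height_leN1 rv _; rewrite v0.
Qed.

(* For a suitable power [h] of [g] the window contains at most one power of
   [h]. *)
Lemma sign_jump g : exists (M : nat) (C : nat), (0 < M)%N /\
  forall v, is_root v ->
  (forall n : int, nonneg (action (zpow (g ^+ M)%g n) v) = nonneg v) \/
  exists (n0 : int) (e1 e2 : bool),
   [/\ forall n : int, n0 < n -> nonneg (action (zpow (g ^+ M)%g n) v) = e1,
       forall n : int, n < n0 -> nonneg (action (zpow (g ^+ M)%g n) v) = e2
     & `|height (action (zpow (g ^+ M)%g n0) v)| <= C%:R].
Proof.
have [M [b [F [M0 MP]]]] := sign_window g.
(* A multiple of [M], so that periodic roots remain fixed, and larger than [2 * b], so that a window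
   of radius [b] contains at most one multiple of it. *)
set M' := (M * (2 * b).+1)%N.
have M'0 : (0 < M')%N by rewrite muln_gt0 M0.
have Mb : (2 * b < M')%N by rewrite /M' -[X in (X <= _)%N]mul1n leq_mul2r M0 orbT.
have [||C CP] := @seq_bound _ (fun v C => forall k, (k <= 2 * M')%N ->
    `|height (action (zpow g (k%:Z - M'%:Z)) v)| <= C%:R) F.
- by move=> v a c ac H k /H/le_trans; apply; rewrite ler_nat.
- move=> v _; have [||C CP] := @seq_bound _ (fun k C =>
    `|height (action (zpow g (k%:Z - M'%:Z)) v)| <= C%:R) (iota 0 (2 * M').+1).
  + by move=> k a c ac /le_trans; apply; rewrite ler_nat.
  + move=> k _; exists (Num.bound `|height (action (zpow g (k%:Z - M'%:Z)) v)|).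
    exact/ltW/archi_boundP/normr_ge0.
  + by exists C => k kM; apply: CP; rewrite mem_iota.
exists M', C; split=> // v rv; case: (MP v rv) => [H|H|[n0 [e1 [e2 [H1 H2 n0F]]]]].
- by left=> n; rewrite zpowX.
- left=> n; have HM : forall n : int, action (zpow (g ^+ M)%g n) v = v.
    move=> {}n; elim: n => [|n IH|n IH]; first by rewrite action1.
      by rewrite -addn1 PoszD zpow1Dr actionM H.
    rewrite -[in LHS]H -actionM -zpow1Dr.
    by have -> : - n.+1%:Z + 1 = - n%:Z by lia.
  by rewrite /M' expgnA zpowX HM.
(* [M' * q] is the least multiple of [M'] that is at least [n0 - b]. It lies within [M'] of [n0],
   where [C] bounds the height. *)
right; set c : int := n0 - b%:Z + M'%:Z - 1; set q := (c %/ M'%:Z)%Z.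
have qE := divz_eq c M'%:Z; rewrite -/q in qE.
have M'N : M'%:Z != 0 by lia.
have r0 := modz_ge0 c M'N; have r1 : (c %% M'%:Z)%Z < M'%:Z by apply: ltz_pmod; lia.
exists q, e1, e2; split.
- move=> n qn; rewrite zpowX; apply: H1.
  have : M'%:Z * (q + 1) <= M'%:Z * n by rewrite ler_wpM2l //; lia.
  by rewrite /c in qE r0 r1; lia.
- move=> n qn; rewrite zpowX; apply: H2.
  have : M'%:Z * n <= M'%:Z * (q - 1) by rewrite ler_wpM2l //; lia.
  by rewrite /c in qE r0 r1; lia.
pose k := absz (M'%:Z * q - n0 + M'%:Z).
have kE : k%:Z = M'%:Z * q - n0 + M'%:Z by rewrite /k /c in qE r0 r1 *; lia.
have := CP _ n0F k; rewrite kE -actionM -zpowD addrK subrK zpowX; apply.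
by rewrite /c in qE r0 r1; lia.
Qed.

(* The linear form [p v = \sum_(r < N) height (h^r v)] evaluates [v] at the
   barycentre of [N] consecutive points of an orbit of [h]; if the sign of [v]
   jumps at most once along the orbit and takes the same limit at both ends,
   then this limit outweighs the single exception. *)
Lemma chamber_near_axis g : exists (M N : nat) x, [/\ (0 < M)%N, (0 < N)%N &
  forall v, is_root v ->
  let f n := nonneg (action x^-1%g (action (zpow (g ^+ M)%g n) v)) in
  (forall n, f n = f 0) \/
  exists (n0 : int) (e : bool),
    (forall n : int, n0 < n -> f n = e) /\ (forall n : int, n <= n0 - N%:Z -> f n = ~~ e)].
Proof.
have [M [C [M0 MP]]] := sign_jump g; set h := (g ^+ M)%g in MP.
(* The [C + 1] unexceptional summands, each at least 1 in the common sign, outweigh the exceptional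
   one, which is at least [- C]. *)
pose N := C.+2; pose p v := \sum_(r < N) height (action (h ^+ r)%g v).
have pD u v : p (u + v) = p u + p v.
  rewrite /p -big_split; apply: eq_bigr => r _; rewrite actionD.
  by rewrite /height -big_split; apply: eq_bigr => i _; rewrite ffunE.
have pZ a v : p (a *: v) = a * p v.
  rewrite /p mulr_sumr; apply: eq_bigr => r _; rewrite actionZ.
  by rewrite /height mulr_sumr; apply: eq_bigr => i _; rewrite ffunZE.
pose Lf (r : nat) := sval (cid (@inversions_finite _ _ _ _ hW R (h ^+ r)%g)).
have LP v : is_root v -> nonneg v -> p v < 0 -> v \in flatten [seq Lf r | r <- iota 0 N].
  (* Positive roots have positive height, so some [h ^+ r] must invert [v]. *)
  move=> rv v0 pv; have [r rv0] : exists r : 'I_N, ~~ nonneg (action (h ^+ r)%g v).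
    apply: contrapT => H; move: pv; rewrite ltNge; apply/negP/negPn.
    apply: sumr_ge0 => r _; apply: le_trans ler01 _; apply: (height_ge1 (hW := hW)).
      exact: root_action.
    by apply: contrapT => rv0; apply: H; exists r; apply/negP.
  apply/flatten_mapP; exists (val r); first by rewrite mem_iota ltn_ord.
  by rewrite /Lf; case: cid => L LP /=; apply: LP.
have [x xP] := @chamber_root _ _ _ _ hW R p _ pD pZ LP.
exists M, N, x; split=> // v rv f; rewrite -/h in f *.
have pf e n : 0 < signed e (p (action (zpow h n) v)) -> f n = e.
  have [x1 x2] := xP _ (root_action (zpow h n) rv).
  by case: e; rewrite /signed /f ?oppr_gt0 => // /x2/negPf.
have signed_sum e n : signed e (p (action (zpow h n) v)) =
    \sum_(r < N) signed e (height (action (zpow h (r%:Z + n)) v)).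
  rewrite /p; transitivity (signed e (\sum_(r < N) height (action (zpow h (r%:Z + n)) v))).
    by congr signed; apply: eq_bigr => r _; rewrite -actionM zpowD.
  by case: e => //=; rewrite sumrN.
have all_e e n : (forall r : 'I_N, nonneg (action (zpow h (r%:Z + n)) v) = e) -> f n = e.
  move=> H; apply: pf; rewrite signed_sum; apply: (@lt_le_trans _ _ (\sum_(r < N) 1)).
    by rewrite sumr_const card_ord ltr0n.
  apply: ler_sum => r _; rewrite -(H r).
  exact/signed_height/root_action.
case: (MP v rv) => [H|[n0 [e1 [e2 [H1 H2 HC]]]]].
  by left=> n; rewrite !(all_e (nonneg v)).
have [e12|e12] := eqVneq e1 e2; last first.
  (* Outside these bounds the [N] indices from [n] to [n + N - 1] lie on one side of [n0]. *)
  right; exists n0, e1; split=> n nn; apply: all_e => r.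
    by apply: H1; lia.
  rewrite H2; last by have := ltn_ord r; lia.
  by move: e12; clear; case: e1; case: e2.
left; suff fe n : f n = e1 by move=> n; rewrite !fe.
have [[r rE]|H] := pselect (exists r : 'I_N, r%:Z + n = n0); last first.
  apply: all_e => r; case: (ltgtP (r%:Z + n) n0) => rn.
  - by rewrite H2.
  - by rewrite H1.
  - by case: H; exists r.
apply: pf; rewrite signed_sum (bigD1 r) //= rE.
have h1 : - C%:R <= signed e1 (height (action (zpow h n0) v)).
  move: HC; rewrite ler_norml /signed => /andP[]; case: e1 {H1 e12} => //.
  by move=> _; rewrite lerN2.
have h2 : C.+1%:R <= \sum_(i < N | i != r) signed e1 (height (action (zpow h (i%:Z + n)) v)).
  apply: (@le_trans _ _ (\sum_(i < N | i != r) 1)).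
    rewrite sumr_const ler_nat.
    by have := cardC1 r; rewrite card_ord => ->.
  apply: ler_sum => i ir; rewrite -[e1](_ : nonneg (action (zpow h (i%:Z + n)) v) = _).
    exact/signed_height/root_action.
  case: (ltgtP (i%:Z + n) n0) => rn; [by rewrite H2|by rewrite H1|].
  have [] : i%:Z = r%:Z by apply: (addIr n); rewrite rn rE.
  by move=> /ord_inj /eqP; rewrite (negPf ir).
rewrite -natr1 in h2; lra.
Qed.

(** Seen from the chamber [x], an orbit changes sign only inside a window of length [N], so under
    [x^-1 * h ^+ N * x] only one index is exceptional. This excludes common inversions of [k ^+ n]
    and [k^-1], and lengths add. *)
Lemma straight_conjugate g : exists (M : nat) x k, [/\ (0 < M)%N,
  (g ^+ M = x * k * x^-1)%g & forall n, len hW (k ^+ n)%g = (n * len hW k)%N].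
Proof.
have [M [N [x [M0 N0 H]]]] := chamber_near_axis g.
set h := (g ^+ M)%g in H; pose k := (x^-1 * h ^+ N * x)%g.
exists (M * N)%N, x, k; split; first by rewrite muln_gt0 M0.
  by rewrite /k expgnA !mulgA mulgV mul1g mulgK.
elim=> [|n IH]; first by rewrite len1.
rewrite expgSr (lenM_eq (R := R)) ?IH ?mulSn 1?addnC // => u ru u0.
have [->|n0] := posnP n; first by rewrite action1 u0 orbT.
pose f (l : int) := nonneg (action (zpow k l) u).
have fE l : f l = nonneg (action x^-1%g (action (zpow h (N%:Z * l)) (action x u))).
  by rewrite /f /k zpow_conj zpowX !actionM.
have f0 : f 0 by rewrite /f action1.
rewrite -zpowN1 -[(k ^+ n)%g]/(zpow k n) -!/(f _).
case: (H _ (root_action x ru)) => [Hc|[q [e [H1 H2]]]].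
  by rewrite fE Hc; move: f0; rewrite fE mulr0 => ->.
have qE := divz_eq q N%:Z; have NN : N%:Z != 0 by lia.
have r0 := modz_ge0 q NN; have r1 : (q %% N%:Z)%Z < N%:Z by apply: ltz_pmod; lia.
(* [N * c] is the only multiple of [N] in the window from [q - N] (excluded) to [q]. *)
set c := (q %/ N%:Z)%Z in qE.
have fr l : c < l -> f l = e.
  move=> cl; rewrite fE; apply: H1.
  have : N%:Z * (c + 1) <= N%:Z * l by rewrite ler_wpM2l //; lia.
  lia.
have fl l : l < c -> f l = ~~ e.
  move=> cl; rewrite fE; apply: H2.
  have : N%:Z * l <= N%:Z * (c - 1) by rewrite ler_wpM2l //; lia.
  lia.
(* Index 0 is positive. If [c < 0] it agrees with index [n], if [c > 0] with index -1; if [c = 0]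
   these two have opposite signs, so one is positive. *)
case: (ltgtP c 0) => c0.
- by rewrite [f n]fr ?(fr 0) // in f0 *; [rewrite f0 orbT|lia].
- by rewrite [f (-1)]fl ?f0 //; [rewrite -(fl 0) // f0|lia].
- by rewrite fl ?[f n]fr ?orNb //; lia.
Qed.

End Dynamics.

(** * Geodesic lines *)

Section CayleyGraph.
Local Open Scope nat_scope.
Local Open Scope group_scope.
Variables (W : groupType) (I : finType) (m : I -> I -> option nat) (s : I -> W).
Hypothesis hW : coxeter_system m s.
Implicit Types (u v x : W) (i j : I).

Notation len := (len hW).
Notation eval := (eval s).

Lemma adjP u v : reflect (exists i, v = u * s i) (cayley_adj s u v).
Proof.
apply: (iffP existsP) => -[i].
  by case/orP => /eqP->; exists i; rewrite ?(genK hW).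
by move=> ->; exists i; rewrite eqxx.
Qed.

Lemma walkP u v n :
  walk_of_length s u v n <-> exists2 w, v = u * eval w & size w = n.
Proof.
split=> [[p [pP <- <-]]|[w -> <-]].
  elim: p u pP => [|x p IH] u /=; first by exists [::]; rewrite // /eval big_nil mulg1.
  move=> /andP[/adjP[i ->] /IH[w -> <-]].
  by exists (i :: w); rewrite // eval_cons mulgA.
elim: w u => [|i w IH] u; first by exists [::]; rewrite /eval big_nil mulg1.
have [p [pP pl ps]] := IH (u * s i); exists (u * s i :: p); split=> /=.
- by rewrite pP andbT; apply/adjP; exists i.
- by rewrite pl eval_cons mulgA.
- by rewrite ps.
Qed.

Lemma cayley_distE u v : cayley_dist s u v = len (u^-1 * v).
Proof.
have [w wE wl] := lenP hW (u^-1 * v).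
apply: xget_unique.
  split; first by apply/walkP; exists w; rewrite // wE mulVKg.
  by move=> k /walkP[w' -> <-]; rewrite mulKg len_eval.
move=> n [/walkP[w' vE <-] nP]; apply/eqP.
rewrite eqn_leq {2}vE mulKg len_eval andbT.
by apply: nP; apply/walkP; exists w; rewrite // wE mulVKg.
Qed.

Lemma len_expg g n : len (g ^+ n) <= n * len g.
Proof.
elim: n => [|n IH]; first by rewrite len1.
by rewrite expgS mulSn; apply: leq_trans (lenM hW _ _) (leq_add (leqnn _) IH).
Qed.

(** * The periodic line of a straight element *)

Section StraightLine.
Variables (k : W) (i0 : I) (w : seq I).
Hypotheses (wk : eval w = k) (wl : size w = len k) (k0 : 0 < len k).
Hypothesis straight : forall n, len (k ^+ n) = (n * len k)%N.
Local Notation L := (len k).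

(** The letters of the infinite word w w w ...; the default [i0] is never reached, because [t %% L]
    is below the size of [w]. *)
Let letter t := nth i0 w (t %% L).
Let ray n := eval (mkseq letter n).

Let rayS n : ray n.+1 = ray n * s (letter n).
Proof. by rewrite /ray mkseqS -cats1 eval_cat eval1. Qed.

Let ray_period : ray L = k.
Proof.
rewrite /ray -[RHS]wk; congr eval; apply: (@eq_from_nth _ i0).
  by rewrite size_mkseq.
by move=> t; rewrite size_mkseq => tL; rewrite nth_mkseq // /letter modn_small.
Qed.

Let ray0 : ray 0 = 1.
Proof. by rewrite /ray /eval big_nil. Qed.

Let ray_add a n : ray (a * L + n) = ray (a * L) * ray n.
Proof.
elim: n => [|n IH]; first by rewrite addn0 ray0 mulg1.
by rewrite addnS !rayS IH mulgA /letter modnMDl.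
Qed.

Let ray_mul a : ray (a * L) = k ^+ a.
Proof.
elim: a => [|a IH]; first by rewrite mul0n ray0.
by rewrite mulSn addnC ray_add ray_period IH expgSr.
Qed.

Let ray_le a d : len ((ray a)^-1 * ray (a + d)) <= d.
Proof.
elim: d => [|d IH]; first by rewrite addn0 mulVg len1.
rewrite addnS rayS mulgA -addn1.
exact: leq_trans (lenM hW _ _) (leq_add IH (len_gen hW _)).
Qed.

(** A shortcut between two vertices of the ray would shorten [k ^+ c] below its length [c * L];
    position [c] precedes [c * L] since [L] is positive. *)
Let ray_dist a d : len ((ray a)^-1 * ray (a + d)) = d.
Proof.
apply/eqP; rewrite eqn_leq ray_le /=.
set c := a + d; have cL : c <= c * L by rewrite leq_pmulr.
have := straight c; rewrite -ray_mul => E.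
have : ray (c * L) = ray a * ((ray a)^-1 * ray c) * ((ray c)^-1 * ray (c + (c * L - c))).
  by rewrite mulVKg mulVKg subnKC.
move=> /(congr1 len); rewrite E => E'.
have l1 : len (ray a) <= a by rewrite -[X in _ <= X](size_mkseq letter) len_eval.
have l2 := ray_le c (c * L - c).
have l3 := lenM hW (ray a * ((ray a)^-1 * ray c)) ((ray c)^-1 * ray (c + (c * L - c))).
have l4 := lenM hW (ray a) ((ray a)^-1 * ray c).
have : c * L <= a + len ((ray a)^-1 * ray c) + (c * L - c).
  rewrite {1}E'; apply: leq_trans l3 (leq_add _ l2).
  exact: leq_trans l4 (leq_add l1 (leqnn _)).
by move: cL; rewrite -/c; move: (c * L)%N (len (_ * ray c)) => A X; clear -c; lia.
Qed.

(** The ray continued to negative times by shifting back [absz z] periods; as [L] is at least 1, the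
    shifted index is nonnegative. *)
Definition line (z : int) : W :=
  k ^- absz z * ray (absz ((absz z)%:Z * L%:Z + z)%R).

(** Independence of the shift lets several vertices be compared on one translate of the ray. *)
Lemma lineE n z : absz z <= n -> line z = k ^- n * ray (absz (n%:Z * L%:Z + z)%R).
Proof.
move=> zn; rewrite /line -(subnK zn).
have -> : absz ((n - absz z + absz z)%N%:Z * L%:Z + z)%R =
    ((n - absz z) * L + absz ((absz z)%:Z * L%:Z + z)%R)%N.
  by nia.
by rewrite ray_add ray_mul expgnDr invgM -!mulgA mulKg.
Qed.

Lemma line_ray z n : absz z <= n -> exists a, (a%:Z = n%:Z * L%:Z + z)%R /\
  line z = k ^- n * ray a.
Proof.
move=> zn; exists (absz (n%:Z * L%:Z + z)%R); split; last exact: lineE.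
by nia.
Qed.

Lemma line_adj z : cayley_adj s (line z) (line (z + 1)%R).
Proof.
have [|a [aE ->]] := @line_ray z (absz z).+1; first lia.
have [|b [bE ->]] := @line_ray (z + 1)%R (absz z).+1; first lia.
have -> : b = a.+1 by lia.
by apply/adjP; exists (letter a); rewrite rayS mulgA.
Qed.

Lemma line_dist z z' : len ((line z)^-1 * line z') = absz (z - z')%R.
Proof.
have [|a [aE ->]] := @line_ray z (absz z + absz z')%N; first lia.
have [|b [bE ->]] := @line_ray z' (absz z + absz z')%N; first lia.
rewrite invgM -mulgA mulKg.
have [ab|/ltnW ba] := leqP a b.
  by rewrite -(subnKC ab) ray_dist; lia.
by rewrite -lenV invgM invgK -(subnKC ba) ray_dist; lia.
Qed.

Lemma line_mul (q : int) : line (q * L%:Z)%R = zpow k q.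
Proof.
set n := (absz q * L)%N.
have [|a [aE ->]] := @line_ray (q * L%:Z)%R n; first by rewrite /n; nia.
have nq : (Posz (absz (n%:Z + q)) = n%:Z + q)%R by rewrite /n; nia.
set t := absz _ in nq.
have aE' : (Posz a = t%:Z * L%:Z)%R by rewrite aE nq mulrDl.
move: aE'; rewrite -PoszM => -[->].
rewrite ray_mul -[k ^+ t]/(zpow k (Posz t)) nq zpowD.
exact: mulKg.
Qed.

End StraightLine.

Theorem straight_line k : k != 1 -> (forall n, len (k ^+ n) = (n * len k)%N) ->
  exists b : int -> W, [/\ forall z, cayley_adj s (b z) (b (z + 1)%R),
    forall z z', len ((b z)^-1 * b z') = absz (z - z')%R &
    forall q, b (q * (len k)%:Z)%R = zpow k q].
Proof.
move=> k1 straight; have [w wk wl] := lenP hW k.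
have k0 : 0 < len k by rewrite lt0n; apply: contraNneq k1 => /len_eq0->.
case: w wk wl => [|i0 w] wk wl; first by rewrite -wl in k0.
exists (line k i0 (i0 :: w)); split.
- exact: line_adj.
- exact: line_dist.
- exact: line_mul.
Qed.

End CayleyGraph.

Theorem corollary6p6 (W : groupType) (I : finType) (m : I -> I -> option nat)
    (s : I -> W) (hW : coxeter_system m s) (g : W) (hg : infinite_order g) :
  exists (K : nat) (D : path_domain) (b : int -> W),
    geodesic_edge_path s D b /\
    forall n : int, exists k : int,
      in_domain D k /\ (cayley_dist s (zpow g n) (b k) <= K)%N.
Proof.
have [M [x [k [M0 gM straight]]]] := straight_conjugate hW Rdefinitions.R g.
(* The infinite order of [g] enters here, through its [M]-th power. *)
have k1 : k != 1%g.
  by apply/eqP => k1; apply: (hg M M0); rewrite gM k1 mulg1 mulgV.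
have [b [b_adj b_dist b_mul]] := straight_line k1 straight.
have dist_mull y z : cayley_dist s (x * y)%g (x * z)%g = len hW (y^-1 * z)%g.
  by rewrite (cayley_distE hW) invgM -mulgA mulKg.
(* For n = M q + r, [g^n] is [x * k^q * x^-1 * g^r]; its distance to the vertex [x * k^q] of the
   translated line is at most [len x + r * len g]. *)
exists (M * len hW g + len hW x)%N, Line, (fun z => (x * b z)%g); split.
  split=> [z _ _|z z' _ _]; last by rewrite dist_mull b_dist.
  have /(adjP hW)[i ->] := b_adj z; apply/(adjP hW); exists i; exact: mulgA.
move=> n; exists ((n %/ Posz M)%Z * (len hW k)%:Z)%R; split=> //.
rewrite b_mul (cayley_distE hW).
have MN : Posz M != 0%R by rewrite eqz_nat -lt0n.
have rE : Posz (absz (n %% Posz M)%Z) = (n %% Posz M)%Z by rewrite gez0_abs ?modz_ge0.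
have rM : (absz (n %% Posz M)%Z < M)%N by rewrite -ltz_nat rE ltz_pmod.
set q := (n %/ Posz M)%Z; set r := absz (n %% Posz M)%Z in rE rM.
have -> : zpow g n = (x * zpow k q * x^-1 * g ^+ r)%g.
  rewrite [n in LHS](divz_eq n (Posz M)) -rE zpowD mulrC -zpowX gM.
  by have := zpow_conj k x^-1 q; rewrite invgK => ->.
rewrite !invgM invgK -!mulgA mulKg mulVg mulg1.
apply: leq_trans (lenM hW _ _) _; rewrite lenV leq_add2r.
by apply: leq_trans (len_expg hW g r) _; rewrite leq_mul2r ltnW ?orbT.
Qed.
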